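(* Let $G$ be a finite simple graph with minimum degree $\delta(G)=k$ for some integer $k\ge 4097$, and suppose that for some integer $t\ge 3$ we have $\mathrm{gir}(G)\ge 8t-2$ and $n(G)\le k^{4t-1}$. Then $c(G)>\pi^{*}(G)$.
   Context: $\mathrm{gir}(G)$ is the girth and $n(G)$ the number of vertices of $G$. The cop number $c(G)$ is the minimum number of cops needed to guarantee capture of a robber in the classical cops and robbers game (cops placed first, robber then chooses a vertex; in each turn each cop may move along an edge or stay, then the robber may move along an edge or stay; capture when a cop occupies the robber's vertex). A configuration of pebbles is a function $C:V(G)\to\mathbb{Z}_{\ge 0}$ of size $\sum_v C(v)$; a pebbling step from a vertex $u$ with at least two pebbles to an adjacent vertex $v$ removes two pebbles from $u$ and adds one to $v$. The optimal pebbling number $\pi^{*}(G)$ is the minimum $m$ such that some configuration of size $m$ allows, for every target vertex, a sequence of pebbling steps placing a pebble on that target. *)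

(* Defs.v *)
From mathcomp Require Import all_boot boolp.

Set Implicit Arguments.
Unset Strict Implicit.
Unset Printing Implicit Defensive.

Record sgraph := SGraph {
  vertex :> finType;
  adj : rel vertex;
  adj_sym : symmetric adj;
  adj_irrefl : irreflexive adj }.
Arguments adj {s}.

Section Invariants.
Variable G : sgraph.

Definition degree (v : G) : nat := #|[set w | adj v w]|.

(* Every degree is smaller than #|G|, so when G has a vertex the neutral
   element #|G| does not affect the minimum. *)
Definition min_degree : nat := \big[minn/#|G|]_(v : G) degree v.

(* ucycle also holds of the empty sequence, of one vertex with a loop and of
   the two ends of an edge, hence the bound on n. *)
Definition has_cycle (n : nat) : Prop :=
  2 < n /\ exists s : seq G, ucycle adj s /\ size s = n.

(* None stands for the infinite girth of a forest. *)
Definition girth : option nat :=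
  if pselect (exists n, `[< has_cycle n >]) is left ex
  then Some (ex_minn ex) else None.

Definition cop_step (m : nat) (C D : {ffun 'I_m -> G}) : Prop :=
  forall i, D i = C i \/ adj (C i) (D i).

Definition robber_walk (r : nat -> G) : Prop :=
  forall n, r n.+1 = r n \/ adj (r n) (r n.+1).

(* A strategy gives the positions of the cops as a function of all positions
   of the robber so far: sigma [::] is the initial placement, and
   sigma [:: r 0; ...; r n] is the placement reached by the cops in answer to
   the robber's arrival in r n.  The robber may be captured in r n upon his own
   arrival there (first disjunct) or by the answer of the cops (second one).
   A play is continued after a capture, which is immaterial, and the robber,
   who may stay, always has a move, so his plays are the infinite walks. *)
Definition cops_win (m : nat) : Prop :=
  exists sigma : seq G -> {ffun 'I_m -> G},
    (forall h x, cop_step (sigma h) (sigma (rcons h x))) /\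
    (forall r, robber_walk r ->
       exists n i, sigma (mkseq r n) i = r n \/ sigma (mkseq r n.+1) i = r n).

Lemma cops_win_exists : exists m, `[< cops_win m >].
Proof.
exists #|G|; apply/asboolP.
exists (fun=> [ffun i => enum_val i]); split=> [h x i|r _]; first by left.
by exists 0, (enum_rank (r 0)); left; rewrite ffunE enum_rankK.
Qed.

Definition cop_number : nat := ex_minn cops_win_exists.

Definition config := {ffun G -> nat}.

Definition config_size (C : config) : nat := \sum_(v : G) C v.

Definition move_pebbles (C : config) (u v : G) : config :=
  [ffun w => C w - (w == u).*2 + (w == v)].

Definition pebbling_step : rel config := fun C D =>
  [exists u : G, exists v : G,
    [&& adj u v, 2 <= C u & D == move_pebbles C u v]].

Definition reachable (C : config) (v : G) : Prop :=
  exists s : seq config, path pebbling_step C s /\ 0 < last C s v.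

Definition has_solvable_config (m : nat) : Prop :=
  exists C : config, config_size C = m /\ forall v, reachable C v.

Lemma has_solvable_config_exists : exists m, `[< has_solvable_config m >].
Proof.
exists (config_size [ffun=> 1]); apply/asboolP.
by exists [ffun=> 1]; split=> // v; exists [::]; rewrite /= ffunE.
Qed.

Definition optimal_pebbling_number : nat :=
  ex_minn has_solvable_config_exists.

End Invariants.

Definition le_girth (m : nat) (G : sgraph) : bool :=
  if girth G is Some g then m <= g else true.

(* Main.v *)
Require Import Defs.
From mathcomp Require Import all_boot boolp zify.

(* Put d = k - 1.  In a graph of girth g, balls of radius less than g / 2 are
   trees, so a ball of radius s = 4t - 2 has at least d^s vertices.  A maximal
   set S of vertices at pairwise distance more than 2s then has at most |G| / d^s
   elements, and 2^(2s) pebbles on each of them reach every vertex.  Since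
   k >= 4097 = 2^12 + 1, this takes fewer than d^t pebbles.

   Fewer than d^t cops lose (Frankl): the robber moves in stages of t steps,
   each along a path of length t that leaves the edge he came by.  These paths
   have at least d^t ends, and, if all cops close to the robber are behind him,
   a cop can spoil only the end, if any, through which the shortest path from
   the cop to the robber goes.  At the end of a stage towards an unspoilt end,
   the cops close to the robber are again behind him. *)

Set Implicit Arguments.
Unset Strict Implicit.
Unset Printing Implicit Defensive.

(** Count the related pairs in both orders: every [x] lies in at least [a] of them, every [y] in at
    most one. *)
Lemma double_counting (T U : finType) (A : {set T}) (B : {set U})
    (R : T -> U -> bool) (a : nat) :
  (forall x, x \in A -> a <= #|[set y in B | R x y]|) ->
  (forall x1 x2 y, x1 \in A -> x2 \in A -> y \in B ->
     R x1 y -> R x2 y -> x1 = x2) ->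
  #|A| * a <= #|B|.
Proof.
move=> Ra Rinj; rewrite -sum_nat_const.
apply: (@leq_trans (\sum_(x in A) \sum_(y in B) R x y)).
  apply: leq_sum => x /Ra /leq_trans; apply.
  rewrite -sum1_card (eq_bigl (fun y => (y \in B) && R x y)); last first.
    by move=> y; rewrite inE.
  by rewrite big_mkcondr leq_sum // => y _; case: (R x y).
rewrite exchange_big -sum1_card; apply: leq_sum => y By /=.
have [/existsP[x /andP[Ax Rxy]]|/existsPn noR] :=
  boolP [exists x, (x \in A) && R x y]; last first.
  by rewrite big1 // => x Ax; have := noR x; rewrite Ax; case: (R x y).
rewrite (bigD1 x) //= Rxy big1 // => z /andP[Az zx].
by case Rzy: (R z y) => //; rewrite (Rinj _ _ _ Az Ax By Rzy Rxy) eqxx in zx.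
Qed.

(** * Distances and trees in graphs of large girth *)

Section Distance.
Variable G : sgraph.
Implicit Types x y z : G.

Fixpoint ball n x : {set G} :=
  if n is n'.+1 then [set z | [exists y in ball n' x, (z == y) || adj y z]]
  else [set x].

Lemma ballS n x z :
  reflect (exists2 y, y \in ball n x & z = y \/ adj y z) (z \in ball n.+1 x).
Proof.
rewrite inE; apply: (iffP exists_inP) => -[y By yz]; exists y => //.
  by case/orP: yz => [/eqP|]; [left|right].
by case: yz => [->|->]; rewrite ?eqxx ?orbT.
Qed.

Lemma ball_trans m n x y z :
  y \in ball m x -> z \in ball n y -> z \in ball (m + n) x.
Proof.
move=> Bxy; elim: n z => [|n IHn] z; first by rewrite inE addn0 => /eqP->.
by case/ballS=> y' /IHn Bxy' y'z; rewrite addnS; apply/ballS; exists y'.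
Qed.

Lemma ball_le m n x y : m <= n -> y \in ball m x -> y \in ball n x.
Proof.
move/subnKC <-; elim: (n - m) => [|i IHi]; first by rewrite addn0.
by move/IHi => By; rewrite addnS; apply/ballS; exists y => //; left.
Qed.

Lemma ball_sym n x y : y \in ball n x -> x \in ball n y.
Proof.
elim: n y => [|n IHn] y; first by rewrite !inE eq_sym.
case/ballS=> z /IHn Bzx zy; rewrite -add1n; apply: ball_trans Bzx.
by apply/ballS; exists y; [rewrite inE|case: zy => [->|]; [left|right; rewrite adj_sym]].
Qed.

Variable g : nat.

(* The truncation at g makes the distance total on disconnected graphs. *)
Definition dist x y := find (fun n => y \in ball n x) (iota 0 g).

Lemma dist_max x y : dist x y <= g.
Proof. by rewrite -[leqRHS](size_iota 0) find_size. Qed.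

Lemma distP n x y : n < g -> (dist x y <= n) = (y \in ball n x).
Proof.
move=> ng; apply/idP/idP => [dn|By].
  apply: ball_le (dn) _; have dg := leq_ltn_trans dn ng.
  have := @nth_find _ 0 (fun n => y \in ball n x) (iota 0 g).
  by rewrite has_find size_iota nth_iota //; exact.
rewrite leqNgt; apply/negP => /(before_find 0).
by rewrite nth_iota // By.
Qed.

Lemma dist_sym x y : dist x y = dist y x.
Proof.
suff le_d u v : dist u v <= dist v u by apply/eqP; rewrite eqn_leq !le_d.
have := dist_max v u; rewrite leq_eqVlt => /predU1P[->|lt_g].
  exact: dist_max.
by rewrite distP // ball_sym // -distP.
Qed.

Lemma dist_triangle y x z : dist x z <= dist x y + dist y z.
Proof.
have [lt_g|ge_g] := ltnP (dist x y + dist y z) g; last first.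
  exact: leq_trans (dist_max _ _) ge_g.
by rewrite distP //; apply: ball_trans; rewrite -distP //; lia.
Qed.

Lemma distxx x : dist x x = 0.
Proof.
case: (posnP g) => [g0|g0]; first by have := dist_max x x; lia.
by apply/eqP; rewrite -leqn0 distP // inE.
Qed.

Lemma dist_eq0 x y : 0 < g -> dist x y = 0 -> x = y.
Proof.
by move=> g0 /eqP; rewrite -leqn0 distP // inE => /eqP.
Qed.

Lemma dist_adj1 x y : adj x y -> dist x y <= 1.
Proof.
move=> xy; case: (ltnP 1 g) => [g1|]; last exact: leq_trans (dist_max _ _).
by rewrite distP //; apply/ballS; exists x; [rewrite inE|right].
Qed.

Lemma dist_adj x y z : adj y z -> dist x z <= (dist x y).+1.
Proof.
move=> /dist_adj1 yz; apply: leq_trans (dist_triangle y _ _) _.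
by rewrite -addn1 leq_add2l.
Qed.

Lemma dist_pred x y n : dist x y = n.+1 -> n.+1 < g ->
  exists2 z, adj z y & dist x z = n.
Proof.
move=> dn ng; have: dist x y <= n.+1 by rewrite dn.
rewrite distP // => /ballS[z Bz [yz|zy]].
  by move: Bz; rewrite -yz -distP; lia.
exists z => //; apply/eqP; rewrite eqn_leq distP ?Bz; last lia.
by have := dist_adj x zy; lia.
Qed.

(** Before [y] the path only meets vertices at distance less than [n] from [x], hence it misses [v].
    Two such paths form the cycle in [unique_parent]. *)
Lemma geodesic x y (v : G) n : dist x y = n -> n < g -> n <= dist x v -> v != y ->
  exists p, [/\ path adj x p, last x p = y, size p = n & v \notin x :: p].
Proof.
elim: n y => [|n IHn] y dn ng nv vy.
  exists [::]; split=> //; first exact: dist_eq0 dn.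
  by rewrite (dist_eq0 _ dn) // inE.
have [z zy dz] := dist_pred dn ng.
have [|||p [Pp Lp Sp vp]] := IHn z dz; try lia.
  by apply: contraTneq nv => ->; lia.
exists (rcons p y); split; first by rewrite rcons_path Pp Lp.
- by rewrite last_rcons.
- by rewrite size_rcons Sp.
- by rewrite -rcons_cons mem_rcons inE negb_or vy.
Qed.

(** * Uniqueness of short paths under the girth hypothesis *)

Hypothesis girthG : le_girth g G.

Lemma girth_le n : has_cycle G n -> g <= n.
Proof.
move: girthG; rewrite /le_girth /girth.
case: pselect => [ex|nex] + cyc; last by case: nex; exists n; apply/asboolP.
by case: ex_minnP => i _ min_i; move/leq_trans; apply; apply/min_i/asboolP.
Qed.

(** Otherwise geodesics from [x] to [y1] and [y2], which avoid [v], would contain together with the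
    two edges at [v] a cycle shorter than [g]. So, near [x], the graph looks like a tree rooted at
    [x]. *)
Lemma unique_parent x (v : G) y1 y2 : adj v y1 -> adj v y2 ->
  dist x y1 <= dist x v -> dist x y2 <= dist x v ->
  dist x y1 + dist x y2 + 2 < g -> y1 = y2.
Proof.
move=> vy1 vy2 d1 d2 dg; apply: contraTeq dg => y12.
have adj_neq z : adj v z -> v != z.
  by apply: contraTneq => <-; rewrite adj_irrefl.
apply/negP => dg; suff: g <= dist x y1 + dist x y2 + 2 by rewrite leqNgt dg.
have [|p1 [P1 L1 S1 v1]] := geodesic (erefl (dist x y1)) _ d1 (adj_neq _ vy1).
  by lia.
have [|p2 [P2 L2 S2 v2]] := geodesic (erefl (dist x y2)) _ d2 (adj_neq _ vy2).
  by lia.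
pose q := rev (belast x p1) ++ p2.
have Pq : path adj y1 q.
  rewrite cat_path -{1}L1 rev_path; apply/andP; split.
    by rewrite (eq_path (e' := adj)) // => a b; rewrite adj_sym.
  suff -> : last y1 (rev (belast x p1)) = x by [].
  by case: (p1) L1 => //= a p <-; rewrite rev_cons last_rcons.
have Lq : last y1 q = y2.
  rewrite last_cat -L2; congr last.
  by case: (p1) L1 => //= a p <-; rewrite rev_cons last_rcons.
have Sq : size q = dist x y1 + dist x y2.
  by rewrite size_cat size_rev size_belast S1 S2.
have vq : v \notin y1 :: q.
  rewrite inE mem_cat mem_rev negb_or adj_neq //= negb_or.
  move: v2; rewrite inE negb_or => /andP[_ ->]; rewrite andbT.
  by apply: contra v1; exact: mem_belast.
(* Shortening the walk to a simple path keeps it off [v], so closing it up through [v] gives a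
   cycle. *)
case/shortenP: Pq Lq => q' Pq' Uq' subq' Lq'.
apply: leq_trans (girth_le (n := size (v :: y1 :: q')) _) _.
  split; first by case: q' Lq' {Pq' Uq' subq'} => //= y12'; rewrite y12' eqxx in y12.
  exists (v :: y1 :: q'); split=> //; apply/andP; split.
    by rewrite /= rcons_path Pq' Lq' vy1 adj_sym vy2.
  rewrite cons_uniq Uq' andbT; apply: contra vq; rewrite !inE.
  by case/orP=> [->//|/(subq' v) ->]; rewrite orbT.
rewrite -Sq /= addn2 !ltnS; apply: uniq_leq_size => //.
by move: Uq' => /= /andP[].
Qed.

(** An edge inside a sphere around [c] would give [b] a second neighbour not farther from [c],
    besides its parent. *)
Lemma adj_dist_neq c a b : adj a b -> (dist c a).*2.+1 < g ->
  dist c a <> dist c b.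
Proof.
move=> ab dg eq_d; case dE: (dist c a) (eq_d) => [|n] dcb.
  move: ab; rewrite -(dist_eq0 _ dE) -?(dist_eq0 _ (esym dcb)) ?adj_irrefl //; lia.
have [z zb dz] := dist_pred (esym dcb) ltac:(lia).
suff az : a = z by move: dz; rewrite -az; lia.
by apply: (@unique_parent c b); rewrite 1?(adj_sym b) //; lia.
Qed.

(** By [unique_parent], the vertex just left is the only neighbour not farther from [c], and the
    walk does not backtrack to it. *)
Lemma dist_away (w : nat -> G) n c :
  (forall i, i < n -> adj (w i) (w i.+1)) ->
  (forall i, i.+1 < n -> w i != w i.+2) ->
  dist c (w 0) < dist c (w 1) -> (dist c (w 0) + n).*2 <= g ->
  dist c (w n) = dist c (w 0) + n.
Proof.
move=> adjw nbw d01 dg.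
(* The induction also carries along that the last step led away from [c]. *)
suff []: dist c (w n) = dist c (w 0) + n /\
    (0 < n -> dist c (w n.-1) < dist c (w n)) by [].
elim: n adjw nbw dg => [|n IHn] adjw nbw dg; first by rewrite addn0.
have [|||dn dn'] := IHn; try by [lia | move=> i ?; apply: adjw; lia
  | move=> i ?; apply: nbw; lia].
suff: dist c (w n) < dist c (w n.+1).
  by have := dist_adj c (adjw n ltac:(lia)); rewrite /=; lia.
case: n adjw nbw dg dn dn' {IHn} => [//|n] adjw nbw dg dn /(_ isT) /= dn'.
rewrite ltnNge; apply/negP => le_d; case/eqP: (nbw n (ltnSn _)).
by apply: (@unique_parent c (w n.+1));
  [rewrite adj_sym adjw | rewrite adjw | lia..].
Qed.

(** Locally the edge [a b] separates the side of [a] from the side of [b], so a cop changes sides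
    only by traversing it. *)
Lemma crossing a b c c' : adj a b -> c' = c \/ adj c c' ->
  dist c a < dist c b -> dist c' b <= dist c' a -> (dist c a).*2 + 3 < g ->
  c = a /\ c' = b.
Proof.
move=> ab cc' dab dab' dg; case: cc' => [eq_c|cc']; first by subst c'; lia.
have dcb := dist_adj c ab.
have Lb := dist_adj b cc'; have La := dist_adj a cc'.
have Lb' : dist b c <= (dist b c').+1 by apply: dist_adj; rewrite adj_sym.
rewrite !(dist_sym a) !(dist_sym b) in La Lb Lb'.
have ne_d : dist c' a <> dist c' b by apply: adj_dist_neq => //; lia.
have [d0|d0] := posnP (dist c a).
  by split; apply: dist_eq0; lia.
(* Seen from [a], both [c] and the neighbour [z] of [c'] towards [b] would be the parent of [c'],
   but their distances to [b] differ. *)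
have [||z zc' dz] := @dist_pred b c' (dist c a).-1; try by rewrite ?(dist_sym b); lia.
have az : dist a z <= dist c a.
  by have := dist_triangle b a z; have := dist_adj1 ab; lia.
suff cz : c = z by move: dz; rewrite -cz dist_sym; lia.
apply: (@unique_parent a c'); rewrite 1?(adj_sym c') // ?(dist_sym a c) ?(dist_sym a c'); lia.
Qed.

(** Both vertices are reached from [u] by [n] steps towards [c], each of them forced by
    [unique_parent]. *)
Lemma unique_on_geodesic n c u x1 x2 :
  dist u x1 <= n -> dist u x2 <= n ->
  dist c x1 + n = dist c u -> dist c x2 + n = dist c u ->
  (dist c u).*2 < g -> x1 = x2.
Proof.
elim: n u => [|n IHn] u d1 d2 e1 e2 dg.
  have eq_u x : dist u x <= 0 -> u = x by move=> ?; apply: dist_eq0; lia.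
  by rewrite -(eq_u _ d1) (eq_u _ d2).
have step x : dist u x <= n.+1 -> dist c x + n.+1 = dist c u ->
    exists2 y, adj u y & dist y x <= n /\ dist c y + 1 = dist c u.
  move=> dux ecx; have := dist_triangle x c u; rewrite (dist_sym x u) => tri.
  have [||z zu dz] := @dist_pred x u n; rewrite 1?(dist_sym x); try lia.
  exists z; first by rewrite adj_sym.
  split; first by rewrite dist_sym dz.
  by have := dist_triangle x c z; have := dist_adj c zu; lia.
have [y1 uy1 [dy1 cy1]] := step x1 d1 e1.
have [y2 uy2 [dy2 cy2]] := step x2 d2 e2.
have y12 : y1 = y2 by apply: (@unique_parent c u); rewrite //; lia.
subst y2; apply: (IHn y1) => //; lia.
Qed.

(** * Growth of spheres and a sparse covering set *)

Variable k : nat.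
Hypothesis degG : forall v : G, k <= degree v.

Lemma card_children x y : (dist x y).*2 + 2 < g ->
  k.-1 <= #|[set z | adj y z & dist x z == (dist x y).+1]|.
Proof.
move=> dg; have := degG y; rewrite /degree.
rewrite -(cardsID [set z | dist x z == (dist x y).+1]) -setIdE.
suff: #|[set w | adj y w] :\: [set z | dist x z == (dist x y).+1]| <= 1.
  rewrite (_ : [set z in _ | _] =
    [set z | adj y z & dist x z == (dist x y).+1]); first lia.
  by apply/setP => z; rewrite !inE.
apply/card_le1_eqP => z1 z2; rewrite !inE => /andP[ne1 yz1] /andP[ne2 yz2].
have := dist_adj x yz1; have := dist_adj x yz2.
by move=> ? ?; apply: (@unique_parent x y) => //; lia.
Qed.

(** Each vertex of [A] has at least [k.-1] children, and by [unique_parent] no child is shared. *)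
Lemma sphere_growth x r (A : {set G}) :
  (forall y, y \in A -> dist x y = r) -> r.*2 + 2 < g ->
  #|A| * k.-1 <=
    #|[set z | dist x z == r.+1 & [exists y in A, adj y z]]|.
Proof.
move=> dA rg; apply: (double_counting (R := adj)) => [y Ay|y1 y2 z Ay1 Ay2].
  rewrite -(dA y Ay) in rg *; apply: leq_trans (card_children rg) _.
  apply/subset_leq_card/subsetP => z; rewrite !inE => /andP[yz ->].
  by rewrite yz !andbT /=; apply/exists_inP; exists y.
rewrite inE => /andP[/eqP dz _] y1z y2z.
by apply: (@unique_parent x z); rewrite 1?adj_sym ?dz ?dA //; lia.
Qed.

Lemma card_ball x r : r.*2 < g -> k.-1 ^ r <= #|[set z | dist x z <= r]|.
Proof.
move=> rg; apply: (@leq_trans #|[set z | dist x z == r]|); last first.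
  by apply/subset_leq_card/subsetP => z; rewrite !inE => /eqP->.
elim: r rg => [|r IHr] rg.
  by rewrite expn0 card_gt0; apply/set0Pn; exists x; rewrite inE distxx.
rewrite expnSr.
apply: leq_trans (_ : #|[set z | dist x z == r]| * k.-1 <= _).
  by rewrite leq_mul2r IHr ?orbT //; lia.
apply: leq_trans (@sphere_growth x r _ _ _) _; try lia.
  by move=> y; rewrite inE => /eqP.
by apply/subset_leq_card/subsetP => z; rewrite !inE => /andP[].
Qed.

(** In the tree rooted at [p], these are the descendants of its child [u] that lie [r] generations
    below [u]. *)
Definition targets p u r := [set x | dist p x == r.+1 & dist u x <= r].

Lemma card_targets p u r : adj p u -> r.*2 + 2 < g ->
  k.-1 ^ r <= #|targets p u r|.
Proof.
move=> pu; elim: r => [|r IHr] rg.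
  rewrite expn0 card_gt0; apply/set0Pn; exists u; rewrite inE distxx andbT.
  rewrite eqn_leq dist_adj1 //= lt0n; apply/eqP => /dist_eq0 e.
  by move: pu; rewrite e ?adj_irrefl //; lia.
rewrite expnSr.
apply: leq_trans (_ : #|targets p u r| * k.-1 <= _).
  by rewrite leq_mul2r IHr ?orbT //; lia.
apply: leq_trans (@sphere_growth p r.+1 _ _ _) _; try lia.
  by move=> y; rewrite inE => /andP[/eqP].
apply/subset_leq_card/subsetP => z; rewrite !inE => /andP[->].
by case/exists_inP=> y; rewrite inE => /andP[_ dy] /(dist_adj u) /leq_trans; apply.
Qed.

(** The distances from [p] show that the path never backtracks, as [dist_away] demands. *)
Lemma target_path p u r x : adj p u -> r.+1 < g -> x \in targets p u r ->
  exists f : nat -> G, [/\ f 0 = p, f 1 = u, f r.+1 = x,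
    forall i, i <= r -> adj (f i) (f i.+1) &
    forall i, i <= r.+1 -> dist p (f i) = i].
Proof.
move=> pu; elim: r x => [|r IHr] x rg; rewrite inE => /andP[/eqP dpx dux].
  have -> : x = u by apply/esym/dist_eq0; lia.
  have dpu : dist p u = 1.
    by rewrite -dpx; congr dist; apply: dist_eq0; lia.
  exists (fun i => if i is 0 then p else u); split=> //.
    by case.
  by case=> [|[]] //; rewrite distxx.
have := dist_triangle u p x; have := dist_adj1 pu => d1 tri.
have [||z zx duz] := @dist_pred u x r; try lia.
have := dist_adj p zx; have := dist_triangle u p z => tri' Lz.
have [||f [f0 f1 fr fadj fd]] := IHr z; try lia.
  by rewrite inE; lia.
exists (fun i => if i <= r.+1 then f i else x); split=> //.
- by rewrite ltnn.
- move=> i ir; rewrite ir; case: leqP => i_r; last exact: fadj.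
  by rewrite (_ : i = r.+1) ?fr //; lia.
move=> i; case: (leqP i r.+1) => [ir _|ir ir']; first exact: fd.
by rewrite dpx; lia.
Qed.

Lemma sparse_cover r : r.*2 < g ->
  exists S : {set G}, #|S| * k.-1 ^ r <= #|G| /\
    forall y, exists2 x, x \in S & y \in ball r.*2 x.
Proof.
move=> rg.
pose sparse (S : {set G}) :=
  [forall x in S, forall y in S, (dist x y <= r.*2) ==> (x == y)].
have sparse0 : sparse set0 by apply/forall_inP => x; rewrite inE.
have [S maxS _] := maxset_exists sparse0.
have sparseS x y : x \in S -> y \in S -> dist x y <= r.*2 -> x = y.
  move=> Sx Sy d_xy; have /forall_inP/(_ x Sx)/forall_inP/(_ y Sy) := maxsetp maxS.
  by rewrite d_xy => /eqP.
exists S; split=> [|y].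
  rewrite -cardsT; apply: (double_counting (R := fun x z => dist x z <= r)).
    move=> x Sx; apply: leq_trans (card_ball x rg) _.
    by apply/subset_leq_card/subsetP => z; rewrite !inE.
  move=> x1 x2 z Sx1 Sx2 _ d1 d2; apply: sparseS => //.
  by have := dist_triangle z x1 x2; rewrite (dist_sym z); lia.
apply: contrapT => far; have farS x : x \in S -> r.*2 < dist x y.
  by move=> Sx; rewrite ltnNge distP //; apply/negP => By; apply: far; exists x.
have yS : y \notin S by apply/negP => /farS; rewrite distxx.
suff /(maxsetsup maxS)/(_ (subsetUr _ _)) SyS : sparse (y |: S).
  by move: yS; rewrite -SyS setU11.
apply/forall_inP => x1 /setU1P Sx1; apply/forall_inP => x2 /setU1P Sx2.
apply/implyP => d12; case: Sx1 Sx2 d12 => [->|Sx1] [->|Sx2] //.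
- by rewrite dist_sym leqNgt farS.
- by rewrite leqNgt farS.
- by move=> d12; apply/eqP/sparseS.
Qed.

(** * The robber's strategy *)

Lemma dist_along (v : nat -> G) n c : (forall i, i < n -> adj (v i) (v i.+1)) ->
  dist c (v 0) <= dist c (v n) + n.
Proof.
elim: n => [|n IHn] adjv; first by rewrite addn0.
have := IHn (fun i lt_in => adjv i (ltnW lt_in)).
by have := dist_adj c (_ : adj (v n.+1) (v n)); rewrite adj_sym adjv //; lia.
Qed.

Variable t : nat.
Hypotheses (t_gt1 : 1 < t) (g_ge : 8 * t - 2 <= g).

(* For a target x at distance t from u: x lies on the shortest path from c
   to u. *)
Definition shadows u x c := (dist c x <= 3 * t - 2) && (dist c x + t == dist c u).

Lemma unshadowed_target m (C : {ffun 'I_m -> G}) p u :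
  adj p u -> m < k.-1 ^ t ->
  exists2 x, x \in targets p u t & forall i, ~~ shadows u x (C i).
Proof.
move=> pu mk; apply: contrapT => noT.
have: #|targets p u t| * 1 <= #|[set: 'I_m]|.
  apply: (double_counting (R := fun x i => shadows u x (C i))) => [x Tx|x1 x2 i].
    rewrite card_gt0; apply/set0Pn; apply: contrapT => noi; apply: noT.
    by exists x => // i; apply/negP => sh; apply: noi; exists i; rewrite !inE.
  rewrite !inE => /andP[_ d1] /andP[_ d2] _ /andP[c1 /eqP e1] /andP[_ /eqP e2].
  (* The range [3 * t - 2] in [shadows] puts the cop within [4 * t - 2] of [u], which is less than
     half of [g]. *)
  by apply: (unique_on_geodesic d1 d2 e1 e2); lia.
by rewrite cardsT card_ord muln1; have := @card_targets p u t pu; lia.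
Qed.

(** A cop near the end of the path but not behind it would, by [dist_away] on the reversed path, be
    [t] farther from [f 1] than from the end, and so shadow the end. *)
Lemma unshadowed_behind (f : nat -> G) c :
  (forall i, i <= t -> adj (f i) (f i.+1)) ->
  (forall i, i <= t.+1 -> dist (f 0) (f i) = i) ->
  ~~ shadows (f 1) (f t.+1) c -> dist c (f t.+1) <= 3 * t - 2 ->
  dist c (f t) < dist c (f t.+1).
Proof.
move=> adjf df + d_x; rewrite /shadows d_x /=; apply: contraNT.
rewrite -leqNgt leq_eqVlt => /predU1P[d_eq|d_lt].
  by case: (@adj_dist_neq c (f t) (f t.+1)); rewrite ?adjf //; lia.
rewrite eq_sym; apply/eqP.
have := @dist_away (fun i => f (t.+1 - i)) t c.
rewrite subn0 subn1 subSnn /=; apply; try by lia.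
- by move=> i it; rewrite adj_sym subSS subSn ?adjf //; lia.
- move=> i it; apply/eqP => /(congr1 (dist (f 0))).
  by rewrite !df; lia.
Qed.

(* The robber is about to walk along v 0, ..., v j.  No cop can reach any of
   these vertices in time, and the cops that can get close to v j by the time
   he is there will all be behind him, on the side of a. *)
Definition evading m (C : {ffun 'I_m -> G}) j (v : nat -> G) a :=
  [/\ j <= t, forall i, i < j -> adj (v i) (v i.+1), adj a (v j),
      forall c, dist (C c) (v j) <= 2 * t - 2 + j ->
        dist (C c) a < dist (C c) (v j) &
      forall c i, i <= j -> i < dist (C c) (v i)].

(** By [crossing], a cop could leave the side of [a] only by starting on [a], which is too near the
    robber's path. The ranges shrink by one to make up for one move of the cops. *)
Lemma evading_step m (C D : {ffun 'I_m -> G}) j v a :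
  evading C j.+1 v a -> cop_step C D -> evading D j (v \o succn) a.
Proof.
move=> [jt adjv av behind far] CD; split=> //=; try by [lia|].
- by move=> i ij; apply: adjv.
- move=> c dc; rewrite ltnNge; apply/negP => le_d.
  have LC : dist (C c) (v j.+1) <= (dist (D c) (v j.+1)).+1.
    rewrite !(dist_sym _ (v j.+1)).
    by case: (CD c) => [->|DC]; [lia | apply: dist_adj; rewrite adj_sym].
  have dC := behind c ltac:(lia).
  have [//|] := crossing av (CD c) dC le_d; first lia.
  move=> Ca _; have := far c j.+1 (leqnn _).
  by have := dist_adj1 av; rewrite Ca; lia.
- move=> c i ij; have := far c i.+1 ij.
  suff : dist (C c) (v i.+1) <= (dist (D c) (v i.+1)).+1 by lia.
  rewrite !(dist_sym _ (v i.+1)).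
  by case: (CD c) => [->|DC]; [lia | apply: dist_adj; rewrite adj_sym].
Qed.

Lemma evading_extend m (C : {ffun 'I_m -> G}) v a :
  m < k.-1 ^ t -> evading C 0 v a ->
  exists v' a', v' 0 = v 0 /\ evading C t v' a'.
Proof.
move=> mk [_ _ pu behind far].
have [x Tx unsh] := unshadowed_target C pu mk.
have [|f [f0 f1 fx adjf df]] := target_path pu _ Tx; first lia.
have x_behind c : dist (C c) (f t.+1) <= 3 * t - 2 ->
    dist (C c) (f t) < dist (C c) (f t.+1).
  by apply: unshadowed_behind; rewrite ?f0 // f1 fx.
exists (fun i => f i.+1), (f t); split=> //; split=> //.
- by move=> i it; apply: adjf.
- exact: adjf.
- by move=> c dc; apply: x_behind; lia.
move=> c i it; rewrite ltnNge; apply/negP => le_i.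
have d_u : dist (C c) (v 0) <= i + i.
  rewrite -f1; have := @dist_along (fun i => f i.+1) i (C c).
  by move=> /(_ (fun j lt_ji => adjf j.+1 ltac:(lia))); lia.
(* From a cop behind the robber, the distance grows by one with each step of the path, so he is
   never in time. *)
have [lt_d|ge_d] := ltnP (dist (C c) a) (dist (C c) (v 0)).
  have := @dist_away f i.+1 (C c).
  rewrite f0 f1 => away; move: le_i; rewrite away; try by lia.
    by move=> j ji; apply: adjf; lia.
  move=> j ji; apply/eqP => /(congr1 (dist (f 0))).
  by rewrite f0 !df; lia.
(* Any other cop is at least [2 * t - 1] away from [v 0], which leaves only [i = t]. Then he is
   behind the end of the path, hence within [t - 1] of [f t] and within [2 * t - 2] of [v 0]. *)
have d_gt : 2 * t - 2 < dist (C c) (v 0).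
  by rewrite ltnNge; apply/negP => d_le; have := behind c; lia.
have eq_it : i = t by lia.
subst i; have := x_behind c ltac:(lia).
have := @dist_along (fun i => f i.+1) t.-1 (C c).
move=> /(_ (fun j lt_ji => adjf j.+1 ltac:(lia))).
by rewrite f1 prednK; lia.
Qed.

(* Here the cops move first, and a cop next to an unshadowed target x could
   capture a robber who starts in x.  He starts one step beyond x instead. *)
Lemma evading_start m (C : {ffun 'I_m -> G}) (p u : G) :
  m < k.-1 ^ t -> adj p u ->
  exists w : G, (forall c, C c != w) /\
    forall D, cop_step C D -> exists a, evading D 0 (fun=> w) a.
Proof.
move=> mk pu.
have [x Tx unsh] := unshadowed_target C pu mk.
have [|f [f0 f1 fx adjf df]] := target_path pu _ Tx; first lia.
have x_behind c : dist (C c) x <= 3 * t - 2 -> dist (C c) (f t) < dist (C c) x.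
  by rewrite -fx; apply: unshadowed_behind; rewrite ?f0 // f1 fx.
have dpx : dist p x = t.+1 by rewrite -fx df.
have: 0 < #|[set z | adj x z & dist p z == (dist p x).+1]|.
  apply: leq_trans (card_children _); last by lia.
  by move: mk; case: (k.-1) => //; rewrite exp0n; lia.
rewrite card_gt0 => /set0Pn[w]; rewrite inE dpx => /andP[xw /eqP dpw].
have ftx : adj (f t) x by rewrite -fx; apply: adjf.
(* From [x], the only neighbour not farther from such a cop is [f t], and [w] is another one. *)
have w_behind c : dist (C c) x <= 3 * t - 2 -> dist (C c) x < dist (C c) w.
  move=> /[dup] d_x /x_behind d_ft; rewrite ltnNge; apply/negP => d_w.
  have eq_w : f t = w.
    by apply: (@unique_parent (C c) x); [rewrite adj_sym | | lia..].
  by have := df t (leqnSn t); rewrite eq_w; lia.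
exists w; split=> [c|D CD].
  apply/eqP => Cw; have := w_behind c; rewrite Cw distxx.
  by have := dist_adj1 xw; rewrite dist_sym; lia.
have behind c : dist (D c) w <= 2 * t - 2 -> dist (D c) x < dist (D c) w.
  move=> d_w; rewrite ltnNge; apply/negP => le_d.
  have d_Cx : dist (C c) x <= 2 * t.
    have LC : dist (C c) w <= (dist (D c) w).+1.
      rewrite !(dist_sym _ w).
      by case: (CD c) => [->|DC]; [lia | apply: dist_adj; rewrite adj_sym].
    by have := dist_adj (C c) (_ : adj w x); rewrite adj_sym => /(_ xw); lia.
  (* A cop changing sides would have stood on [x], which [x_behind] excludes. *)
  have [||Cx _] := crossing xw (CD c) (w_behind c _) le_d; try lia.
  by have := x_behind c; rewrite Cx distxx; lia.
exists x; split=> //; first by move=> c; rewrite addn0; apply: behind.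
by move=> c i; rewrite leqn0 => /eqP->; have := behind c; lia.
Qed.

Lemma cops_lose m : (exists p u : G, adj p u) -> cops_win G m -> k.-1 ^ t <= m.
Proof.
move=> [p [u pu]] [sigma [sigma_step sigma_win]].
rewrite leqNgt; apply/negP => mk.
have [r0 [r0_free r0_next]] := evading_start (sigma [::]) mk pu.
(* The invariant after each answer of the cops: the robber is at [v 0] with [j] steps of his stage
   left. *)
pose good h := exists j v a, v 0 = last r0 h /\ evading (sigma h) j v a.
pose next h y := [/\ adj (last r0 h) y, forall c, sigma h c != y &
  good (rcons h y)].
have good_next h : good h -> exists y, next h y.
  suff one j v a : v 0 = last r0 h -> evading (sigma h) j.+1 v a ->
      exists y, next h y.
    (* If [j] is 0 the stage is over and a new one of [t] steps is planned. *)
    move=> [[|j] [v [a [v0 ev]]]]; last exact: one v0 ev.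
    have [v' [a' [v0']]] := evading_extend mk ev.
    by rewrite -(prednK (ltnW t_gt1)) => /one; apply; rewrite v0'.
  move=> v0 ev; exists (v 1); have [_ adjv _ _ far] := ev.
  split; first by rewrite -v0; apply: adjv.
    by move=> c; apply/eqP => Cv; have := far c 1 isT; rewrite Cv distxx.
  exists j, (v \o succn), a; rewrite last_rcons; split=> //.
  exact: evading_step ev (sigma_step h (v 1)).
have [h|f nextf] := @choice _ _ (fun h y => good h -> next h y).
  by have [/good_next[y]|] := pselect (good h); [exists y | exists r0].
pose hist n := iter n (fun h => rcons h (f h)) [:: r0].
have goodh n : good (hist n).
  elim: n => [|n IHn]; last by case: (nextf _ IHn).
  have [a ev] := r0_next _ (sigma_step [::] r0).
  by exists 0, (fun=> r0), a.
pose r n := last r0 (hist n).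
have rS n : r n.+1 = f (hist n) by rewrite /r /= last_rcons.
have histE n : hist n = mkseq r n.+1.
  elim: n => // n IHn; rewrite mkseqS -IHn rS //.
have [|n [c]] := sigma_win r.
  by move=> n; right; rewrite rS; case: (nextf _ (goodh n)).
(* Capture by the robber's own move is excluded by [next], or by [r0_free] at the start; capture by
   the cops' answer is excluded by the invariant. *)
rewrite -histE => -[].
  case: n => [|n]; first by apply/eqP; rewrite /= r0_free.
  by rewrite -histE rS; apply/eqP; case: (nextf _ (goodh n)).
have [j [v [a [v0 [_ _ _ _ far]]]]] := goodh n.
by move=> Cr; have := far c 0 isT; rewrite v0 Cr distxx.
Qed.

End Distance.

(** * Pebbling from a covering set *)

Section Pebbling.
Variable G : sgraph.
Implicit Types (C D : config G) (x y z : G).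

(** The term [C z] lets the induction move one pebble at a time. *)
Lemma pebble_edge j C y z : adj y z -> j.*2 <= C y ->
  exists s, path (@pebbling_step G) C s /\ C z + j <= last C s z.
Proof.
move=> yz; have zy : (z == y) = false.
  by apply/eqP => zy; move: yz; rewrite zy adj_irrefl.
elim: j C => [|j IHj] C jC; first by exists [::]; rewrite addn0.
have [|s [Ps Ls]] := IHj (move_pebbles C y z).
  by rewrite ffunE eqxx eq_sym zy; lia.
exists (move_pebbles C y z :: s); split=> /=.
  rewrite Ps andbT; apply/existsP; exists y; apply/existsP; exists z.
  by rewrite yz eqxx andbT; lia.
by apply: leq_trans Ls; rewrite ffunE eqxx zy; lia.
Qed.

(** Each edge halves the supply, so [j.*2] pebbles must arrive one vertex earlier. *)
Lemma pebble_ball n j C x y : 2 ^ n * j <= C x -> y \in ball n x ->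
  exists s, path (@pebbling_step G) C s /\ j <= last C s y.
Proof.
elim: n j y => [|n IHn] j y Cx.
  by rewrite inE => /eqP->; exists [::]; rewrite /=; lia.
case/ballS=> z /(IHn j.*2)[|s [Ps Ls]]; first by rewrite expnS in Cx; lia.
case=> [->|zy]; first by exists s; split=> //; lia.
have [s' [Ps' Ls']] := pebble_edge zy Ls.
exists (s ++ s'); rewrite cat_path Ps last_cat; split=> //; lia.
Qed.

Lemma optimal_pebbling_le n (S : {set G}) :
  (forall y, exists2 x, x \in S & y \in ball n x) ->
  optimal_pebbling_number G <= #|S| * 2 ^ n.
Proof.
move=> coverS; rewrite /optimal_pebbling_number; case: ex_minnP => p _; apply.
apply/asboolP; exists [ffun x => if x \in S then 2 ^ n else 0]; split.
  rewrite /config_size -sum_nat_const [RHS]big_mkcond.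
  by apply: eq_bigr => x _; rewrite ffunE.
move=> y; have [x Sx yx] := coverS y.
by apply: pebble_ball yx; rewrite ffunE Sx muln1.
Qed.

Lemma min_degree_le (v : G) : min_degree G <= degree v.
Proof.
rewrite /min_degree; have := mem_index_enum v.
elim: (index_enum G) => // w s IHs; rewrite inE big_cons.
by case/predU1P=> [->|/IHs]; [exact: geq_minl | exact/leq_trans/geq_minr].
Qed.

End Pebbling.

(** * Numerical estimate and conclusion *)

Lemma pebbling_bound_lt k t : 4097 <= k -> 3 <= t ->
  k ^ (4 * t - 1) * 2 ^ (4 * t - 2).*2 < k.-1 ^ (5 * t - 2).
Proof.
move=> k_ge t_ge; have [K eK] : exists K, K = k.-1 by exists k.-1.
have -> : k = K.+1 by lia.
have K_ge : 2 ^ 12 <= K by rewrite (_ : 2 ^ 12 = 4096) //; lia.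
have le4 : K.+1 ^ 4 <= 2 * K ^ 4.
  (* [K] is so large that [K.+1 / K <= 7 / 6], and [(7 / 6) ^ 4 < 2]. *)
  have le2 : 36 * K.+1 ^ 2 <= 49 * K ^ 2 by nia.
  rewrite -[4]/(2 * 2) !expnM; move: (K.+1 ^ 2) (K ^ 2) le2 => a b; nia.
(* The extra factor [K.+1] completes the exponent to [4 * t], so that [le4] applies [t] times. *)
rewrite -(ltn_pmul2r (_ : 0 < K.+1)) // /=.
rewrite mulnAC -expnSr.
have -> : (4 * t - 1).+1 = 4 * t by lia.
have -> : K ^ (5 * t - 2) = K ^ (4 * t) * K ^ (t - 2).
  by rewrite -expnD; congr (_ ^ _); lia.
apply: leq_ltn_trans (_ : 2 ^ t * K ^ (4 * t) * 2 ^ (4 * t - 2).*2 < _).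
  by rewrite leq_mul2r expnM (expnM K) -expnMn leq_exp2r ?le4 ?orbT //; lia.
(* This rests on [9 * t - 4 <= 12 * (t - 1)], which is where [3 <= t] enters. *)
have le_pow : 2 ^ (t + (4 * t - 2).*2) <= K ^ (t - 1).
  apply: (@leq_trans ((2 ^ 12) ^ (t - 1))); last by rewrite leq_exp2r //; lia.
  by rewrite -expnM leq_exp2l //; lia.
rewrite mulnAC -expnD mulnC -mulnA ltn_pmul2l ?expn_gt0; last by lia.
apply: leq_ltn_trans le_pow _.
have -> : t - 1 = (t - 2).+1 by lia.
by rewrite expnSr ltn_pmul2l // expn_gt0; lia.
Qed.

Theorem theorem3 (G : sgraph) (k t : nat)
  (k_ge : 4097 <= k) (mindeg : min_degree G = k)
  (t_ge : 3 <= t) (girth_ge : le_girth (8 * t - 2) G)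
  (order_le : #|G| <= k ^ (4 * t - 1)) :
  optimal_pebbling_number G < cop_number G.
Proof.
have degG (v : G) : k <= degree v by rewrite -mindeg min_degree_le.
have [p [u pu]] : exists p u : G, adj p u.
  (* Without vertices, [min_degree G] would be its default [#|G|], that is 0. *)
  have [v _|noG] := pickP (@predT G); last first.
    have : min_degree G = 0 by rewrite /min_degree big_pred0 ?eq_card0.
    by lia.
  have: 0 < degree v by have := degG v; lia.
  by rewrite card_gt0 => /set0Pn[w]; rewrite inE; exists v, w.
(* [4 * t - 2] is the largest radius whose double is below [8 * t - 2]. *)
have [|S [cardS coverS]] := sparse_cover girth_ge degG (r := 4 * t - 2); first lia.
apply: leq_ltn_trans (optimal_pebbling_le coverS) _.
apply: (@leq_trans (k.-1 ^ t)); last first.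
  rewrite /cop_number; case: ex_minnP => m /asboolP win _.
  by apply: (cops_lose girth_ge degG _ _ _ win); [lia | lia | exists p, u].
(* Multiplying by this power avoids dividing in the bound on [#|S|]. *)
have K_gt0 : 0 < k.-1 ^ (4 * t - 2) by rewrite expn_gt0; lia.
rewrite -(ltn_pmul2r K_gt0) -expnD mulnAC.
have -> : t + (4 * t - 2) = 5 * t - 2 by lia.
apply: leq_ltn_trans (pebbling_bound_lt k_ge t_ge).
by rewrite leq_mul2r (leq_trans cardS order_le) orbT.
Qed.
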